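(* Let $p$ be a prime, $e,r\ge 1$ integers, $s\geq 0$ an integer, and let $R=GR(p^e,r)$ be the Galois ring of characteristic $p^e$ and cardinality $p^{er}$. Let $\alpha,\beta$ be units of $R$ and assume there exists a unit $\alpha_0\in R$ with $\alpha_0^{p^s}=\alpha$. Then there are exactly $1+ep^s$ $(\alpha+\beta p)$-constacyclic codes of length $p^s$ over $R$. They are precisely the ideals $C_i=\langle(\alpha_0^{-1}x-1)^i\rangle$, $0\le i\le ep^s$, of $\mathcal{R}(\alpha,\beta)=R[x]/\langle x^{p^s}-(\alpha+\beta p)\rangle$, and the number of codewords in $C_i$ is $|C_i|=p^{r(ep^s-i)}$.
   Context: The Galois ring $GR(p^e,r)$ is $\mathbb{Z}_{p^e}[x]/(f(x))$ where $f$ is a monic polynomial of degree $r$ whose reduction modulo $p$ is irreducible in $\mathbb{F}_p[x]$; it is local with maximal ideal $\langle p\rangle$ and residue field $\mathbb{F}_{p^r}$. A linear code of length $n$ over $R$ is an $R$-submodule of $R^n$. For a unit $\lambda\in R$, a linear code $C\subseteq R^n$ is $\lambda$-constacyclic if $(\lambda c_{n-1},c_0,\ldots,c_{n-2})\in C$ whenever $(c_0,\ldots,c_{n-1})\in C$; identifying $(c_0,\ldots,c_{n-1})$ with $c_0+c_1x+\cdots+c_{n-1}x^{n-1}$, the $\lambda$-constacyclic codes are the ideals of $R[x]/\langle x^n-\lambda\rangle$. *)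

(* Defs.v *)
From HB Require Import structures.
From mathcomp Require Import all_boot all_order all_algebra.

Set Implicit Arguments.
Unset Strict Implicit.
Unset Printing Implicit Defensive.

Import GRing.Theory.
Local Open Scope ring_scope.

(* Lets the finite and ring structures of [{poly %/ h}] be inferred jointly. *)
HB.instance Definition _ (R : finComNzRingType) (h : {poly R}) :=
  GRing.ComNzRing.on {poly_(size (mk_monic h)).-1 R}.

Definition modp_reduction (p e : nat) (a : 'Z_(p ^ e)) : 'F_p := (a : nat)%:R.

Definition galois_poly (p e r : nat) (f : {poly 'Z_(p ^ e)}) : Prop :=
  [/\ f \is monic, size f = r.+1
    & irreducible_poly (map_poly (@modp_reduction p e) f)].

(* [{poly %/ f}] is the quotient by [f] only when [f] is monic of size > 1
   (otherwise it is the quotient by ['X]); [galois_poly r f] with [0 < r]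
   guarantees this, and then [galois_ring f] is GR(p^e, r). *)
Definition galois_ring (p e : nat) (f : {poly 'Z_(p ^ e)}) : predArgType :=
  {poly %/ f}.

Section GaloisRing.
Variables (p e : nat) (f : {poly 'Z_(p ^ e)}).

HB.instance Definition _ := FinRing.ComNzRing.copy (galois_ring f) {poly %/ f}.
(* Units of a finite ring are decided by exhaustive search for an inverse. *)
HB.instance Definition _ := FinRing.isNzRing.Build (galois_ring f).

Lemma card_galois_ring r :
    prime p -> (0 < e)%N -> (0 < r)%N -> galois_poly r f ->
  #|galois_ring f| = (p ^ (e * r))%N.
Proof.
move=> p_pr e_gt0 r_gt0 [fm fs _].
have pe_gt1 : (1 < p ^ e)%N by rewrite -(exp1n e) ltn_exp2r // prime_gt1.
by rewrite card_monic_qpoly ?fs // card_ord Zp_cast // -expnM.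
Qed.

Lemma unit_galois_ringD (a b : galois_ring f) :
    prime p -> (0 < e)%N -> a \is a GRing.unit ->
  a + b * p%:R \is a GRing.unit.
Proof.
move=> p_pr e_gt0 ua.
have pe_gt1 : (1 < p ^ e)%N by rewrite -(exp1n e) ltn_exp2r // prime_gt1.
have p_nilp : (p%:R : galois_ring f) ^+ e = 0.
  rewrite -natrX; apply: val_inj; rewrite /= qpolyC_natr.
  by rewrite -polyC_natr -Zp_nat_mod // modnn.
have -> : a + b * p%:R = a * (1 - (- (a^-1 * b * p%:R))).
  by rewrite opprK mulrDr mulr1 !mulrA mulrV // mul1r.
rewrite unitrM ua andTb; set u := - (a^-1 * b * p%:R).
have ue : u ^+ e = 0 by rewrite /u exprNn exprMn p_nilp !mulr0.
apply/unitrPr; exists (\sum_(i < e) u ^+ i).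
have := subrX1 u e; rewrite ue sub0r => /(congr1 -%R).
by rewrite opprK -mulNr opprB => <-.
Qed.

End GaloisRing.

Section Codes.
Variables (R : finComNzRingType) (n : nat).
Implicit Types (lambda : R) (c : 'rV[R]_n) (C : {set 'rV[R]_n}).

Definition linear_code C : bool :=
  (0 \in C) &&
  [forall a : R, forall u in C, forall v in C, a *: u + v \in C].

Lemma linear_codeP C : reflect (submod_closed C) (linear_code C).
Proof.
apply: (iffP andP) => [[C0 /forallP Clin]|[C0 Clin]]; split=> //.
  by move=> a u v Cu Cv; have /forall_inP/(_ u Cu)/forall_inP/(_ v Cv) := Clin a.
apply/forallP => a; apply/forall_inP => u Cu; apply/forall_inP => v Cv.
exact: Clin.
Qed.

(* [ord_pred] is the cyclic predecessor on ['I_n], sending 0 to n - 1. *)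
Definition constashift lambda c : 'rV[R]_n :=
  \row_(i < n)
    (if (i : nat) == 0%N then lambda * c 0 (ord_pred i) else c 0 (ord_pred i)).

Definition constacyclic lambda C : bool :=
  linear_code C && [forall c in C, constashift lambda c \in C].

Definition constacyclic_ring lambda : predArgType := {poly %/ 'X^n - lambda%:P}.

HB.instance Definition _ lambda :=
  FinRing.ComNzRing.copy (constacyclic_ring lambda) {poly %/ 'X^n - lambda%:P}.

Definition poly_class lambda (q : {poly R}) : constacyclic_ring lambda :=
  in_qpoly ('X^n - lambda%:P) q.

(* [rVpoly c] is the polynomial c_0 + c_1 X + ... + c_(n-1) X^(n-1). *)
Definition word_class lambda c : constacyclic_ring lambda :=
  poly_class lambda (rVpoly c).

Definition code_of lambda (I : {set constacyclic_ring lambda}) :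
    {set 'rV[R]_n} :=
  [set c | word_class lambda c \in I].

Lemma word_class_bij lambda : (0 < n)%N -> bijective (word_class lambda).
Proof.
move=> n_gt0; pose h := 'X^n - lambda%:P.
have mh : mk_monic h = h.
  by rewrite /mk_monic size_XnsubC // monicXnsubC // ltnS n_gt0.
have sh : size (mk_monic h) = n.+1 by rewrite mh size_XnsubC.
exists (fun q : {poly %/ h} => poly_rV (q : {poly R})) => [c|q].
  by rewrite in_qpoly_small ?rVpolyK // -/h sh ltnS size_poly.
have sq : (size (q : {poly R}) <= n)%N.
  by rewrite -ltnS; apply: leq_trans (size_mk_monic q) _; rewrite sh.
rewrite /word_class poly_rV_K //; apply: val_inj.
exact: in_qpoly_small (size_mk_monic q).
Qed.

End Codes.

Definition principal_ideal (Q : finComNzRingType) (g : Q) : {set Q} :=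
  [set q * g | q : Q].

(* Main.v *)
(** Put y = alpha0^-1 x - 1 in Q = R[x]/(x^n - lambda) with n = p^s.  Modulo
    p y, (1 + y)^n is 1 + y^n; since (1 + y)^n = alpha^-1 lambda is 1 + p times
    a unit, y^n is p times a unit.  Hence y^(en) = 0, and every element of Q is
    a representative of the residue field plus a multiple of y, so that it is
    either a unit or a multiple of y; thus the ideals of Q are the (y^i).  The
    successive indices in Q = (1) >= (y) >= ... >= (y^(en)) = 0 are at most
    p^r, and |Q| = p^(ren) forces all of them to be equal to p^r. *)
From HB Require Import structures.
Require Import Defs.
From mathcomp Require Import all_boot all_order all_algebra.
From mathcomp Require Import ring.

Set Implicit Arguments.
Unset Strict Implicit.
Unset Printing Implicit Defensive.

Import GRing.Theory.
Local Open Scope ring_scope.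

(** * Nilpotent perturbations and [p]-power expansions in commutative rings *)

(** Geometric series: [(a + u) * b = 1 - v] with [v = - (b * u)] nilpotent. *)
Lemma nilpotentD_unit (Q : comNzRingType) (a b u : Q) m :
  a * b = 1 -> u ^+ m = 0 -> exists c, (a + u) * c = 1.
Proof.
move=> ab um; pose v := - (b * u).
have vm : v ^+ m = 0 by rewrite /v exprNn exprMn um !mulr0.
exists (b * \sum_(i < m) v ^+ i).
rewrite mulrA mulrDl ab (mulrC u) -[b * u]opprK -/v.
by rewrite -[1 - v]opprB mulNr -subrX1 vm sub0r opprK.
Qed.

Lemma exprD_prime (Q : comNzRingType) p (a b : Q) : prime p ->
  exists c, (a + b) ^+ p = a ^+ p + b ^+ p + p%:R * (a * b * c).
Proof.
case: p => // p p_pr.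
(* The prime is now [p.+1]. Every inner binomial term contains [a * b], and its coefficient is
   divisible by the prime; the witness is what remains after dividing both out. *)
exists (\sum_(i < p) (a ^+ (p - i.+1) * b ^+ i) *+ ('C(p.+1, i.+1) %/ p.+1)).
rewrite exprDn big_ord_recl big_ord_recr /= subn0 expr0 mulr1 mulr1n.
rewrite /bump /= !add1n subnn expr0 mul1r binn mulr1n -!addrA; congr (_ + _).
rewrite addrC; congr (_ + _); rewrite !mulr_sumr.
apply: eq_bigr => i _; rewrite /bump /= add1n subSS.
have dvd : (p.+1 %| 'C(p.+1, i.+1))%N by rewrite prime_dvd_bin //= ltnS ltn_ord.
rewrite -{1}(divnK dvd) mulrnA -[LHS]mulr_natl; congr (_ * _).
rewrite mulrnAr; congr (_ *+ _).
have -> : (p - i = (p - i.+1).+1)%N by rewrite subnSK.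
by rewrite !exprS -!mulrA; congr (_ * _); rewrite mulrCA.
Qed.

(** The factor [y] kept in the error term matters: it will be nilpotent, so that the error only
    perturbs a unit. *)
Lemma expr1D_pprime (Q : comNzRingType) p s (y : Q) : prime p ->
  exists g, (1 + y) ^+ (p ^ s) = 1 + y ^+ (p ^ s) + p%:R * (y * g).
Proof.
move=> p_pr; elim: s => [|s [g IHs]].
  by exists 0; rewrite !expr1 !mulr0 addr0.
have [a ya] : exists a, y ^+ (p ^ s) = y * a.
  by exists (y ^+ (p ^ s).-1); rewrite -exprS prednK // expn_gt0 prime_gt0.
have [b] := exprD_prime (1 + y ^+ (p ^ s)) (p%:R * (y * g)) p_pr.
have [c] := exprD_prime 1 (y ^+ (p ^ s)) p_pr.
rewrite expnSr !exprM IHs => -> ->; rewrite expr1n mul1r.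
(* The summands come from the cross term of [(1 + y ^+ (p ^ s)) ^+ p], from the [p]-th power of the
   old error, and from the cross term between the two. *)
exists (a * c + p%:R ^+ p.-1 * y ^+ p.-1 * g ^+ p
        + (1 + y ^+ (p ^ s)) * p%:R * g * b).
have expSP (x : Q) : x ^+ p = x * x ^+ p.-1.
  by rewrite -exprS prednK // prime_gt0.
rewrite !exprMn (expSP p%:R) (expSP y) ya.
ring.
Qed.

(** Comparing the two expressions for [(1 + y) ^+ (p ^ s)] gives [y ^+ (p ^ s) = p (b - y g)]. As
    [p] is nilpotent, so is [y], and [b - y g] is a unit along with [b]. *)
Lemma pprime_expr_associate (Q : comNzRingType) p e s (y b b' : Q) :
    prime p -> (p%:R : Q) ^+ e = 0 -> b * b' = 1 ->
    (1 + y) ^+ (p ^ s) = 1 + p%:R * b ->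
  exists w w', w * w' = 1 /\ y ^+ (p ^ s) = p%:R * w.
Proof.
move=> p_pr pe bb'; have [g ->] := expr1D_pprime s y p_pr.
rewrite -addrA => /addrI yg.
have yn : y ^+ (p ^ s) = p%:R * (b - y * g) by rewrite mulrBr -yg addrK.
have [||w' ww'] := @nilpotentD_unit Q b b' (- (y * g)) (p ^ s * e).
- by [].
- by rewrite exprNn exprMn (exprM y) yn exprMn pe !mul0r mulr0.
by exists (b - y * g), w'.
Qed.

(** * Finite chain rings: the ideals are the powers of [y], and their sizes follow from the size of
    the ring *)

Section ChainRing.
Variables (Q : finComNzRingType) (y : Q) (N : nat) (K : finType) (phi : K -> Q).
Hypothesis yN : y ^+ N = 0.
Hypothesis unit_or_multiple :
  forall z, (exists w, z * w = 1) \/ (exists z', z = y * z').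
Hypothesis phi_modulo : forall z, exists k z', z = phi k + y * z'.
Hypothesis cardQ : #|Q| = (#|K| ^ N)%N.

Lemma mem_principal_ideal (g z : Q) :
  reflect (exists q, z = q * g) (z \in principal_ideal g).
Proof.
by apply: (iffP imsetP) => [[q _ ->]|[q ->]]; exists q.
Qed.

(** Divide by [y] until the quotient is a unit; if this has not happened after [N] divisions, then
    [z] is a multiple of [y ^+ N = 0]. *)
Lemma chain_factor (z : Q) :
  exists i u, [/\ (i <= N)%N, z = u * y ^+ i & exists w, u * w = 1].
Proof.
have split m : (exists i u, [/\ (i <= m)%N, z = u * y ^+ i & exists w, u * w = 1])
    \/ exists z', z = z' * y ^+ m.
  elim: m => [|m [[i [u [im zE u1]]]|[z' ->]]].
  - by right; exists z; rewrite mulr1.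
  - by left; exists i, u; split=> //; apply: leqW.
  - have [u1|[z'' ->]] := unit_or_multiple z'; first by left; exists m, z'.
    by right; exists z''; rewrite exprS mulrA (mulrC y).
have [//|[z' ->]] := split N.
by exists N, 1; rewrite yN !mulr0; split=> //; exists 1; rewrite mulr1.
Qed.

Lemma chain_ideal (I : {set Q}) :
    0 \in I -> (forall a u v, u \in I -> v \in I -> a * u + v \in I) ->
  exists2 i, (i <= N)%N & I = principal_ideal (y ^+ i).
Proof.
move=> I0 Ilin.
have IM a u : u \in I -> a * u \in I.
  by move=> Iu; rewrite -[_ * _]addr0 Ilin.
have exI : exists i, y ^+ i \in I by exists N; rewrite yN.
(* The least power of [y] in [I] generates it: a member [u * y ^+ j] with [u] a unit puts [y ^+ j]
   in [I], so [i <= j]. *)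
case: (ex_minnP exI) => i Ii imin.
exists i; first by apply: imin; rewrite yN.
apply/setP=> z; apply/idP/mem_principal_ideal => [Iz|[q ->]]; last exact: IM.
have [j [u [_ zE [w uw]]]] := chain_factor z.
have ij : (i <= j)%N.
  by apply: imin; rewrite -[_ ^+ j]mul1r -uw (mulrC u) -mulrA -zE IM.
by exists (u * y ^+ (j - i)); rewrite -mulrA -exprD subnK.
Qed.

(** Multiplying [z = phi k + y * z'] by [y ^+ i] writes each member of the larger ideal as
    [phi k * y ^+ i] plus a member of the smaller one. *)
Lemma card_chain_idealS i :
  (#|principal_ideal (y ^+ i)| <= #|K| * #|principal_ideal (y ^+ i.+1)|)%N.
Proof.
pose h (kz : K * Q) := phi kz.1 * y ^+ i + kz.2.
pose X := setX [set: K] (principal_ideal (y ^+ i.+1)).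
apply: leq_trans (_ : (#|h @: X| <= _)%N).
  apply/subset_leq_card/subsetP => _ /mem_principal_ideal[z ->].
  have [k [z' ->]] := phi_modulo z.
  apply/imsetP; exists (k, z' * y ^+ i.+1); last first.
    by rewrite /h /= mulrDl exprS mulrA (mulrC y).
  by rewrite !inE /=; apply/mem_principal_ideal; exists z'.
by apply: leq_trans (leq_imset_card _ _) _; rewrite cardsX cardsT.
Qed.

Lemma card_chain_ideal i : (i <= N)%N ->
  #|principal_ideal (y ^+ i)| = (#|K| ^ (N - i))%N.
Proof.
move=> iN; apply/eqP; rewrite eqn_leq; apply/andP; split.
  (* Upper bound: climb from the zero ideal [(y ^+ N)], gaining at most a factor [#|K|] per step. *)
  rewrite -{1}(subKn iN); elim: (N - i)%N (leq_subr i N) => [|m IHm] mN.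
    rewrite subn0 yN expn0 -(cards1 (0 : Q)); apply/subset_leq_card/subsetP.
    by move=> _ /mem_principal_ideal[q ->]; rewrite mulr0 inE.
  apply: leq_trans (card_chain_idealS _) _.
  by rewrite subnSK // expnS leq_mul2l IHm ?orbT // ltnW.
have K_gt0 : (0 < #|K|)%N.
  by have [k _] := phi_modulo 0; apply/card_gt0P; exists k.
(* Lower bound: descending from the whole ring loses at most a factor [#|K|] per step, so [#|Q|] is
   at most [#|K| ^ i] times the size of [(y ^+ i)]. *)
rewrite -(@leq_pmul2l (#|K| ^ i)) ?expn_gt0 ?K_gt0 // -expnD subnKC // -cardQ.
elim: i {iN} => [|i IHi].
  rewrite mul1n; apply/subset_leq_card/subsetP => z _.
  by apply/mem_principal_ideal; exists z; rewrite mulr1.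
by apply: leq_trans IHi _; rewrite expnSr -mulnA leq_mul2l card_chain_idealS orbT.
Qed.

End ChainRing.

(** * Reduction of the Galois ring modulo [p] *)

Section GaloisRingResidue.
Variables (p e : nat).
Hypotheses (p_pr : prime p) (e_gt0 : (0 < e)%N).
Let red : 'Z_(p ^ e) -> 'F_p := @modp_reduction p e.

Let pe_gt1 : (1 < p ^ e)%N.
Proof. by rewrite -(exp1n e) ltn_exp2r // prime_gt1. Qed.

Lemma modp_reduction_nat m : red m%:R = m%:R.
Proof.
rewrite /red /modp_reduction val_Zp_nat //.
by rewrite -[LHS]Fp_nat_mod // modn_dvdm ?dvdn_exp // Fp_nat_mod.
Qed.

Lemma modp_reduction_is_nmod_morphism : nmod_morphism red.
Proof.
split=> [|a b]; first exact: (modp_reduction_nat 0).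
by rewrite -[a in LHS]natr_Zp -[b in LHS]natr_Zp -natrD modp_reduction_nat natrD.
Qed.

Lemma modp_reduction_is_monoid_morphism : monoid_morphism red.
Proof.
split=> [|a b]; first exact: (modp_reduction_nat 1).
by rewrite -[a in LHS]natr_Zp -[b in LHS]natr_Zp -natrM modp_reduction_nat natrM.
Qed.

HB.instance Definition _ :=
  GRing.isNmodMorphism.Build _ _ red modp_reduction_is_nmod_morphism.
HB.instance Definition _ :=
  GRing.isMonoidMorphism.Build _ _ red modp_reduction_is_monoid_morphism.

(** Only a set-theoretic section of the reduction, not a ring morphism. *)
Definition modp_lift (a : 'F_p) : 'Z_(p ^ e) := (a : nat)%:R.

Lemma modp_liftK : cancel modp_lift red.
Proof. by move=> a; rewrite modp_reduction_nat natr_Zp. Qed.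

Lemma map_modp_liftK (g : {poly 'F_p}) :
  map_poly red (map_poly modp_lift g) = g.
Proof.
by apply/polyP => i; rewrite coef_map coef_map_id0 //= modp_liftK.
Qed.

Lemma ker_modp_reduction a : red a = 0 -> a = ((a : nat) %/ p)%N%:R *+ p.
Proof.
move=> /(congr1 val) /=; rewrite val_Fp_nat // => /eqP pa.
by rewrite -mulrnA divnK ?natr_Zp.
Qed.

Lemma ker_map_modp_reduction (g : {poly 'Z_(p ^ e)}) :
  map_poly red g = 0 -> exists h, g = h * p%:R.
Proof.
move=> g0; exists (\poly_(i < size g) ((g`_i)%R %/ p)%N%:R).
apply/polyP => i; rewrite mulr_natr coefMn coef_poly.
case: ltnP => [_|gi]; last by rewrite mul0rn nth_default.
by apply: ker_modp_reduction; rewrite -coef_map g0 coef0.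
Qed.

Variables (r : nat) (f : {poly 'Z_(p ^ e)}).
Hypotheses (r_gt0 : (0 < r)%N) (fP : galois_poly r f).

Let pi : {rmorphism {poly 'Z_(p ^ e)} -> galois_ring f} := in_qpoly f.

Let mk_monicf : mk_monic f = f.
Proof. by case: fP => fm fs _; rewrite /mk_monic fs fm ltnS r_gt0. Qed.

Let pi_surj z : exists2 g : {poly 'Z_(p ^ e)}, (size g <= r)%N & z = pi g.
Proof.
have sz := size_mk_monic z; exists z.
  by case: fP => _ fs _; rewrite -ltnS -fs -{2}mk_monicf.
exact/esym/val_inj/in_qpoly_small.
Qed.

Let pi_f : pi f = 0.
Proof.
apply: val_inj; rewrite /= mk_monicf; case: fP => fm _ _.
exact: Pdiv.RingMonic.rmodpp.
Qed.

Lemma galois_ring_natr_nilp : (p%:R : galois_ring f) ^+ e = 0.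
Proof.
rewrite -natrX; apply: val_inj; rewrite /= qpolyC_natr.
by rewrite -polyC_natr -Zp_nat_mod // modnn.
Qed.

(** The residue field is represented by the [p ^ r] polynomials over ['F_p] of size at most [r],
    lifted coefficientwise. *)
Definition residue_lift (k : {poly_r 'F_p}) : galois_ring f :=
  pi (map_poly modp_lift k).

Lemma galois_ring_modp z : exists k z', z = residue_lift k + z' * p%:R.
Proof.
have [g gr ->] := pi_surj z.
pose k := npolyp r (map_poly red g).
have kE : k = map_poly red g :> {poly _}.
  by rewrite npolypK // (leq_trans (size_poly _ _)).
have [h gh] : exists h, g - map_poly modp_lift k = h * p%:R.
  by apply: ker_map_modp_reduction; rewrite rmorphB /= map_modp_liftK kE subrr.
exists k, (pi h); rewrite /residue_lift.
rewrite -[g](subrK (map_poly modp_lift k)) gh addrC.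
by rewrite rmorphD rmorphM rmorph_nat.
Qed.

Lemma galois_ring_unit_or_modp (z : galois_ring f) :
  (exists w, z * w = 1) \/ (exists z', z = z' * p%:R).
Proof.
have [g gr ->] := pi_surj z.
have [fm fs firr] := fP.
have [g0|g_neq0] := eqVneq (map_poly red g) 0.
  right; have [h ->] := ker_map_modp_reduction g0.
  by exists (pi h); rewrite rmorphM rmorph_nat.
left.
(* A nonzero reduction of degree below [r] is coprime to the irreducible reduction of [f]. The
   lifted Bezout identity holds up to a multiple of [p], which is nilpotent, so it still inverts [g]
   modulo [f]. *)
have : coprimep (map_poly red g) (map_poly red f).
  rewrite coprimep_sym irreducible_poly_coprime //.
  apply/negP => /dvdp_leq-/(_ g_neq0).
  rewrite size_map_poly_id0 ?(monicP fm) ?rmorph1 ?oner_neq0 // fs.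
  by apply/negP; rewrite -ltnNge ltnS (leq_trans (size_poly _ _)).
move=> /Bezout_eq1_coprimepP[[u v] /= uv].
have [h uvh] : exists h, map_poly modp_lift u * g + map_poly modp_lift v * f - 1
  = h * p%:R.
  apply: ker_map_modp_reduction.
  by rewrite !(rmorphB, rmorphD, rmorphM) /= !map_modp_liftK uv rmorph1 subrr.
have [w uw] : exists w, (1 + pi h * p%:R) * w = 1.
  by apply: (@nilpotentD_unit _ _ 1 _ e); rewrite ?mulr1 // exprMn
    galois_ring_natr_nilp mulr0.
exists (pi (map_poly modp_lift u) * w).
have uge : map_poly modp_lift u * g = 1 + h * p%:R - map_poly modp_lift v * f.
  by rewrite -uvh; ring.
rewrite mulrA -[pi g * _]mulrC -[RHS]uw; congr (_ * _).
have -> : pi (map_poly modp_lift u) * pi g = pi (map_poly modp_lift u * g).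
  by rewrite rmorphM.
by rewrite uge rmorphB rmorphD !rmorphM rmorph1 rmorph_nat pi_f mulr0 subr0.
Qed.

End GaloisRingResidue.

(** * Constacyclic codes as ideals of the quotient ring *)

Section CodesAsIdeals.
Variables (R : finComNzRingType) (n : nat) (lambda : R).
Hypothesis n_gt0 : (0 < n)%N.
Let Q := constacyclic_ring n lambda.
Let cl : {rmorphism {poly R} -> Q} := in_qpoly ('X^n - lambda%:P).

Lemma poly_class_modulus : cl ('X^n) = cl lambda%:P.
Proof.
apply/eqP; rewrite -subr_eq0 -rmorphB; apply/eqP.
apply: val_inj; rewrite /= /mk_monic size_XnsubC // ltnS n_gt0.
by rewrite monicXnsubC //= Pdiv.RingMonic.rmodpp // monicXnsubC.
Qed.

Lemma word_class0 : word_class lambda (0 : 'rV[R]_n) = 0.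
Proof. by rewrite -[LHS]/(cl (rVpoly 0)) linear0 rmorph0. Qed.

Lemma word_class_lin a (u v : 'rV[R]_n) :
  word_class lambda (a *: u + v)
    = cl a%:P * word_class lambda u + word_class lambda v.
Proof. by rewrite -rmorphM -rmorphD mul_polyC -linearP. Qed.

(** Multiplication by ['X] moves the last coordinate to degree [n]; the multiple of the modulus
    carries it back to degree 0 with the factor [lambda]. *)
Lemma rVpoly_constashift (c : 'rV[R]_n) :
  'X * rVpoly c = rVpoly (constashift lambda c)
     + (rVpoly c)`_n.-1 *: ('X^n - lambda%:P).
Proof.
case: n n_gt0 c => // m _ c; apply/polyP => i.
rewrite coefXM coefD coefZ coefB coefXn coefC /=.
case: i => [|i] /=.
  rewrite -[0%N]/(val (@ord0 m)) (coef_rVpoly_ord _ ord0) mxE /= sub0r.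
  rewrite -[m in _`_m]/(val (@ord_max m)) (coef_rVpoly_ord _ ord_max).
  have -> : ord_pred (@ord0 m) = ord_max.
    by apply: val_inj; rewrite /= modn_small.
  by rewrite mulrN mulrC subrr.
rewrite eqSS subr0.
(* Degree [i.+1] lies inside the word, beyond degree [n], or at [n = m.+1] itself, where only the
   leading term of the modulus contributes. *)
have [im|mi|->] := ltngtP i m.
- rewrite mulr0 addr0.
  rewrite -[i.+1]/(val (Ordinal (im : i.+1 < m.+1)%N)) coef_rVpoly_ord mxE /=.
  rewrite -[in LHS](_ : val (ord_pred (Ordinal (im : i.+1 < m.+1)%N)) = i).
    by rewrite coef_rVpoly_ord.
  by rewrite /= modnDr modn_small // ltnS ltnW.
- by rewrite mulr0 addr0 !coef_rVpoly !insubF // ltnNge ?ltnS ?mi // ltnW.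
- rewrite mulr1 [X in _ = X + _]coef_rVpoly insubF ?add0r //.
  by rewrite ltnn.
Qed.

Lemma word_class_constashift c :
  word_class lambda (constashift lambda c) = cl 'X * word_class lambda c.
Proof.
rewrite -[word_class lambda c]/(cl (rVpoly c)) -rmorphM rVpoly_constashift.
rewrite rmorphD -mul_polyC rmorphM rmorphB poly_class_modulus subrr.
by rewrite mulr0 addr0.
Qed.

Lemma card_constacyclic_ring : #|Q| = (#|R| ^ n)%N.
Proof. by rewrite -(bij_eq_card (word_class_bij lambda n_gt0)) card_mx mul1n. Qed.

Lemma poly_class_surj (z : Q) : exists g, z = cl g.
Proof.
have [w _ wK] := word_class_bij lambda n_gt0.
by exists (rVpoly (w z)); rewrite -[LHS]wK.
Qed.

Lemma card_code_of (I : {set Q}) : #|code_of I| = #|I|.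
Proof.
rewrite -(on_card_preimset (f := word_class lambda)); last first.
  exact/onW_bij/word_class_bij.
by congr #|pred_of_set _|; apply/setP => c; rewrite !inE.
Qed.

Lemma constacyclic_code_of (I : {set Q}) :
    0 \in I -> (forall a u v, u \in I -> v \in I -> a * u + v \in I) ->
  constacyclic lambda (code_of I).
Proof.
move=> I0 Ilin; apply/andP; split.
  apply/linear_codeP; split=> [|a u v]; rewrite !inE.
    by rewrite word_class0.
  by move=> Iu Iv; rewrite word_class_lin Ilin.
apply/forall_inP => c; rewrite !inE word_class_constashift => Ic.
by rewrite -[_ * _]addr0 Ilin.
Qed.

Lemma constacyclic_ideal (D : {set 'rV[R]_n}) : constacyclic lambda D ->
  exists I : {set Q}, [/\ D = code_of I, 0 \in I
    & forall a u v, u \in I -> v \in I -> a * u + v \in I].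
Proof.
move=> /andP[/linear_codeP[D0 Dlin] /forall_inP Dshift].
have inj := bij_inj (word_class_bij lambda n_gt0).
pose I : {set Q} := word_class lambda @: D.
have ID c : (word_class lambda c \in I) = (c \in D) by rewrite mem_imset.
have I0 : 0 \in I.
  by rewrite -word_class0 ID.
have Ilin a u v : u \in I -> v \in I -> cl a%:P * u + v \in I.
  move=> /imsetP[c Dc ->] /imsetP[d Dd ->].
  by rewrite -word_class_lin ID Dlin.
have IX u : u \in I -> cl 'X * u \in I.
  by move=> /imsetP[c Dc ->]; rewrite -word_class_constashift ID Dshift.
exists I; split=> // [|z u v]; first by apply/setP => c; rewrite inE ID.
have [g ->] := poly_class_surj z.
(* Horner induction with [u] and [v] general: [(g X + a) u + v = g (X u) + (a u + v)], where the
   shift handles [X u] and linearity handles [a u + v]. *)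
elim/poly_ind: g u v => [|g a IHg] u v Iu Iv; first by rewrite rmorph0 mul0r add0r.
rewrite rmorphD rmorphM mulrDl -mulrA -addrA.
by apply: IHg; [exact: IX | exact: Ilin].
Qed.

End CodesAsIdeals.

(** * The ambient ring as a chain ring, and the resulting list of codes *)

Theorem corollary5p5 (p e r s : nat) (f : {poly 'Z_(p ^ e)})
    (alpha beta alpha0 : galois_ring f) :
  prime p -> (0 < e)%N -> (0 < r)%N -> galois_poly r f ->
  alpha \is a GRing.unit -> beta \is a GRing.unit ->
  alpha0 \is a GRing.unit -> alpha0 ^+ (p ^ s) = alpha ->
  let n := (p ^ s)%N in
  let lambda := alpha + beta * p%:R in
  let C (i : nat) : {set constacyclic_ring n lambda} :=
    principal_ideal (poly_class n lambda (alpha0^-1 *: 'X - 1) ^+ i) in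
  [/\ #|[set D : {set 'rV[galois_ring f]_n} | constacyclic lambda D]|
        = (1 + e * p ^ s)%N,
      [set D : {set 'rV[galois_ring f]_n} | constacyclic lambda D]
        = [set code_of (C i) | i : 'I_(e * p ^ s).+1]
    & forall i : nat, (i <= e * p ^ s)%N ->
        #|code_of (C i)| = (p ^ (r * (e * p ^ s - i)))%N].
Proof.
move=> p_pr e_gt0 r_gt0 fP ua ub ua0 a0E n lambda C.
have n_gt0 : (0 < n)%N by rewrite expn_gt0 prime_gt0.
pose Q := constacyclic_ring n lambda.
pose cl : {rmorphism {poly galois_ring f} -> Q} := in_qpoly ('X^n - lambda%:P).
pose y : Q := cl (alpha0^-1 *: 'X - 1); pose N := (e * n)%N.
pose phi (k : {poly_r 'F_p}) : Q := cl (residue_lift f k)%:P.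
have clp (z : galois_ring f) : cl (z * p%:R)%:P = p%:R * cl z%:P.
  by rewrite polyCM rmorphM polyC_natr rmorph_nat mulrC.
have pe0 : (p%:R : Q) ^+ e = 0.
  rewrite -(rmorph_nat cl) -polyC_natr -rmorphXn.
  rewrite -[X in cl X](polyC_exp e (p%:R : galois_ring f)).
  by rewrite galois_ring_natr_nilp // polyC0 rmorph0.
(* Since [1 + y] is the class of [alpha0^-1 *: 'X], its [n]-th power is [alpha^-1 * lambda]. *)
have y1 : (1 + y) ^+ n = 1 + p%:R * cl (alpha^-1 * beta)%:P.
  have -> : 1 + y = cl (alpha0^-1)%:P * cl 'X.
    by rewrite /y rmorphB rmorph1 addrC subrK -mul_polyC rmorphM.
  rewrite exprMn -!rmorphXn poly_class_modulus // -rmorphM -polyCM.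
  rewrite exprVn a0E mulrDr mulVr // polyCD rmorphD rmorph1.
  by rewrite mulrA clp.
have [w [w' [ww' yn]]] : exists w w', w * w' = 1 /\ y ^+ n = p%:R * w.
  (* Invertibility of [beta] enters here: it makes the cofactor of [p] a unit. *)
  apply: (pprime_expr_associate (b' := cl (beta^-1 * alpha)%:P) p_pr pe0 _ y1).
  by rewrite -rmorphM -polyCM -mulrA mulVKr // mulVr // rmorph1.
have py : p%:R = y * (y ^+ n.-1 * w').
  by rewrite mulrA -exprS prednK // yn -mulrA ww' mulr1.
have yN : y ^+ N = 0 by rewrite /N mulnC exprM yn exprMn pe0 mul0r.
have split_const z : exists c z', z = cl c%:P + y * z'.
  have [g ->] := poly_class_surj n_gt0 z.
  (* Modulo [y] the variable equals [alpha0], so [g] is congruent to the constant [g.[alpha0]];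
     explicitly, ['X - alpha0] is [alpha0] times the polynomial defining [y]. *)
  have /factor_theorem[h gh] : root (g - g.[alpha0]%:P) alpha0.
    by rewrite /root !hornerE subrr.
  exists g.[alpha0], (cl (alpha0%:P * h)).
  rewrite -rmorphM -rmorphD; congr (cl _).
  rewrite -[LHS](subrK g.[alpha0]%:P) gh addrC; congr (_ + _).
  rewrite mulrA mulrC; congr (_ * _).
  by rewrite mulrBl mul1r -scalerAl mulrC mul_polyC scalerA mulVr // scale1r.
have unit_or_multiple z : (exists w, z * w = 1) \/ (exists z', z = y * z').
  have [c [z' ->]] := split_const z.
  (* A unit constant stays a unit after adding the nilpotent [y * z']; otherwise [p], hence [y],
     divides the constant. *)
  have [[d cd]|[d ->]] := galois_ring_unit_or_modp p_pr e_gt0 r_gt0 fP c.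
    left; apply: (@nilpotentD_unit _ _ (cl d%:P) _ N).
      by rewrite -rmorphM -polyCM cd rmorph1.
    by rewrite exprMn yN mul0r.
  right; exists (y ^+ n.-1 * w' * cl d%:P + z').
  by rewrite clp py mulrDr !mulrA.
have phi_modulo z : exists k z', z = phi k + y * z'.
  have [c [z' ->]] := split_const z.
  have [k [d ->]] := galois_ring_modp p_pr e_gt0 r_gt0 fP c.
  exists k, (y ^+ n.-1 * w' * cl d%:P + z').
  by rewrite polyCD rmorphD clp py mulrDr -addrA !mulrA.
have cardK : #|{poly_r 'F_p}| = (p ^ r)%N by rewrite card_npoly card_Fp.
have cardQ : #|Q| = (#|{poly_r 'F_p}| ^ N)%N.
  rewrite card_constacyclic_ring // (card_galois_ring p_pr e_gt0 r_gt0 fP).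
  by rewrite cardK -!expnM -mulnA mulnCA.
have CE i : C i = principal_ideal (y ^+ i) by [].
have cardC i : (i <= N)%N -> #|code_of (C i)| = (p ^ (r * (N - i)))%N.
  move=> iN; rewrite card_code_of // CE.
  by rewrite (card_chain_ideal yN phi_modulo cardQ) // cardK expnM.
have codesE : [set D : {set 'rV[galois_ring f]_n} | constacyclic lambda D]
        = [set code_of (C i) | i : 'I_N.+1].
  apply/setP => D; rewrite inE; apply/idP/imsetP => [|[i _ ->]].
    move=> /(constacyclic_ideal n_gt0)[I [-> I0 Ilin]].
    have [i iN ->] := chain_ideal yN unit_or_multiple I0 Ilin.
    by exists (Ordinal (iN : (i < N.+1)%N)).
  apply: constacyclic_code_of => // [|a u v].
    by apply/mem_principal_ideal; exists 0; rewrite mul0r.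
  move=> /mem_principal_ideal[u' ->] /mem_principal_ideal[v' ->].
  by apply/mem_principal_ideal; exists (a * u' + v'); rewrite mulrDl mulrA.
(* The codes are pairwise distinct because their sizes are. *)
split=> //; rewrite codesE card_imset ?card_ord // => i j Cij.
have leN (k : 'I_N.+1) : (k <= N)%N by rewrite -ltnS.
have : #|code_of (C i)| = #|code_of (C j)| by rewrite Cij.
rewrite !cardC // => /eqP; rewrite eqn_exp2l ?prime_gt1 //.
rewrite eqn_pmul2l // => /eqP ij.
by apply: val_inj; rewrite /= -(subKn (leN i)) ij subKn.
Qed.
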